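(* Consider the system $\dot x(t)=f(x(t),u(t),w(t))$, $y(t)=h(x(t),u(t),w(t))$ with $x(t)\in\mathcal{X}\subseteq\mathbb{R}^n$, $u(t)\in\mathcal{U}\subseteq\mathbb{R}^m$, $w(t)\in\mathcal{W}\subseteq\mathbb{R}^q$, $y(t)\in\mathcal{Y}\subseteq\mathbb{R}^p$. Assume that $f$ is continuously differentiable in all of its arguments, $h$ is affine in $(x,w)$, the sets $\mathcal{X}$ and $\mathcal{W}$ are convex, and the input signals $u$ and $w$ are piecewise right-continuous. For $(x,u,w)\in\mathcal{X}\times\mathcal{U}\times\mathcal{W}$ let $$A=\frac{\partial f}{\partial x}(x,u,w),\quad B=\frac{\partial f}{\partial w}(x,u,w),\quad C=\frac{\partial h}{\partial x}(x,u,w),\quad D=\frac{\partial h}{\partial w}(x,u,w).$$ If there exist symmetric matrices $P,Q,R\succ0$ and a constant $\kappa>0$ such that $$\begin{bmatrix}PA+A^\top P+\kappa P-C^\top RC & PB-C^\top RD\\ B^\top P-D^\top RC & -D^\top RD-Q\end{bmatrix}\preceq0$$ holds for all $(x,u,w)\in\mathcal{X}\times\mathcal{U}\times\mathcal{W}$, then $U(x_1,x_2)=|x_1-x_2|_P^2$ is a smooth i-iIOSS Lyapunov function on $\mathcal{X}\times\mathcal{U}\times\mathcal{W}$ that satisfies the quadratic bounds with $P_1=P_2=P$ and $\lambda=e^{-\kappa}$; that is, $|\chi_1-\chi_2|_P^2\le U(\chi_1,\chi_2)\le|\chi_1-\chi_2|_P^2$ and $$U(x_1(t),x_2(t))\le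 U(\chi_1,\chi_2)\lambda^t+\int_0^t\lambda^{t-\tau}\big(|w_1(\tau)-w_2(\tau)|_Q^2+|y_1(\tau)-y_2(\tau)|_R^2\big)d\tau,\qquad\lambda=e^{-\kappa},$$ for all $t\ge0$, all $\chi_1,\chi_2\in\mathcal{X}$, and all admissible $u,w_1,w_2$, where $x_j(\tau)=x(\tau,\chi_j,u,w_j)$ and $y_j(\tau)=y(\tau,\chi_j,u,w_j)$ for $j=1,2$.
   Context: $|x|_M^2=x^\top Mx$ for symmetric $M\succ0$. The maps $f:\mathcal{X}\times\mathcal{U}\times\mathcal{W}\to\mathbb{R}^n$ and $h:\mathcal{X}\times\mathcal{U}\times\mathcal{W}\to\mathcal{Y}$ are jointly continuous, and $\mathcal{X}$ and $\mathcal{W}$ are closed. Admissible signals $u:\mathbb{R}_{\ge0}\to\mathcal{U}$ and $w:\mathbb{R}_{\ge0}\to\mathcal{W}$ are measurable, locally essentially bounded and piecewise right-continuous (in particular, for every $t\ge0$ there is $\epsilon>0$ such that the signal is continuous on $[t,t+\epsilon)$). For every $\chi\in\mathcal{X}$ and all admissible $u,w$, the solution of $\dot x=f(x,u,w)$ with $x(0)=\chi$ is assumed to be unique and to exist, with values in $\mathcal{X}$, on all of $\mathbb{R}_{\ge0}$; it is denoted $x(t,\chi,u,w)$, with output $y(t,\chi,u,w)=h(x(t,\chi,u,w),u(t),w(t))$. An i-iIOSS (incrementally integral input/output-to-state stable) Lyapunov function is a continuous $U:\mathcal{X}\times\mathcal{X}\to\mathbb{R}_{\ge0}$ for which there exist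 $\alpha_1,\alpha_2,\sigma_w,\sigma_y\in\mathcal{K}_\infty$ (continuous, strictly increasing, unbounded functions $\mathbb{R}_{\ge0}\to\mathbb{R}_{\ge0}$ vanishing at $0$) and $\lambda\in[0,1)$ such that $\alpha_1(|\chi_1-\chi_2|)\le U(\chi_1,\chi_2)\le\alpha_2(|\chi_1-\chi_2|)$ and $$U(x_1(t),x_2(t))\le U(\chi_1,\chi_2)\lambda^t+\int_0^t\lambda^{t-\tau}\big(\sigma_w(|w_1(\tau)-w_2(\tau)|)+\sigma_y(|y_1(\tau)-y_2(\tau)|)\big)d\tau$$ for all $t\ge0$, $\chi_1,\chi_2\in\mathcal{X}$ and all admissible $u,w_1,w_2$, with $x_j(\tau)=x(\tau,\chi_j,u,w_j)$, $y_j(\tau)=y(\tau,\chi_j,u,w_j)$. *)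

(* Defs.v *)
(* MathComp-Analysis, over an abstract field of reals [K : realType].
   Points of R^n are column vectors ['cV[K]_n]. *)
From HB Require Import structures.
From mathcomp Require Import all_boot all_order all_algebra.
From mathcomp Require Import all_classical all_reals all_analysis.

Set Implicit Arguments.
Unset Strict Implicit.
Unset Printing Implicit Defensive.

Import Order.TTheory GRing.Theory Num.Theory.
Import numFieldNormedType.Exports.

Local Open Scope classical_set_scope.
Local Open Scope ring_scope.

(* The canonical norm [`|v|] on matrices is the maximum norm, hence a separate
   Euclidean norm. *)
Definition enorm (K : realType) n (v : 'cV[K]_n) : K :=
  Num.sqrt ((v^T *m v) ord0 ord0).

(* [wsqnorm M v] is |v|_M^2 = v^T M v. *)
Definition wsqnorm (K : realType) n (M : 'M[K]_n) (v : 'cV[K]_n) : K :=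
  (v^T *m M *m v) ord0 ord0.

Definition posdef (K : realType) n (M : 'M[K]_n) : Prop :=
  M^T = M /\ forall v : 'cV[K]_n, v != 0 -> 0 < wsqnorm M v.

Definition negsemidef (K : realType) n (M : 'M[K]_n) : Prop :=
  M^T = M /\ forall v : 'cV[K]_n, wsqnorm M v <= 0.

(* Functions on [0, +oo) are functions on [K] whose values at negative
   arguments are irrelevant; nonnegativity on [0, +oo) follows. *)
Definition class_Kinf (K : realType) (alpha : K -> K) : Prop :=
  [/\ {within `[0, +oo[, continuous alpha},
      alpha 0 = 0,
      (forall s t : K, 0 <= s -> s < t -> alpha s < alpha t)
    & (forall M : K, exists2 s : K, 0 <= s & M < alpha s)].

Fixpoint Ck (K : realType) (V : normedModType K) (k : nat) (g : V -> K) : Prop :=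
  continuous g /\
  if k is k'.+1 then
    forall v : V, (forall z, derivable g z v) /\ Ck k' (fun z => 'D_v g z)
  else True.

(* On a finite-dimensional [V], this is C^infinity. *)
Definition smooth (K : realType) (V : normedModType K) (g : V -> K) : Prop :=
  forall k, Ck k g.

(* Fréchet derivative relative to [S]: only increments that stay in [S] are
   considered, so that [g] need not be defined, nor [S] be open, around [z].
   When [z] is interior to [S] and [L] is continuous and linear, this is the
   usual differential. *)
Definition is_derivative_within (K : realType) (V W : normedModType K)
    (S : set V) (g : V -> W) (z : V) (L : V -> W) : Prop :=
  forall e : K, 0 < e -> \forall z' \near within S (nbhs z),
    `|g z' - g z - L (z' - z)| <= e * `|z' - z|.

Section Signals.
Variable K : realType.

(* Piecewise right-continuous on [0, +oo): right-continuous everywhere, with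
   finitely many discontinuities in every bounded interval.  In particular,
   every t >= 0 has some e > 0 such that the signal is continuous on
   [t, t + e); left limits need not exist. *)
Definition piecewise_right_continuous k (s : K -> 'cV[K]_k) : Prop :=
  (forall t : K, 0 <= t -> s x @[x --> t^'+] --> s t) /\
  (forall T : K, finite_set [set t | 0 < t <= T /\ ~ {for t, continuous s}]).

Definition locally_ess_bounded k (s : K -> 'cV[K]_k) : Prop :=
  forall T : K, exists M : K,
    {ae lebesgue_measure, forall t, `[0, T]%classic t -> enorm (s t) <= M}.

Definition admissible k (S : set 'cV[K]_k) (s : K -> 'cV[K]_k) : Prop :=
  [/\ (forall t : K, 0 <= t -> S (s t)),
      (forall i, measurable_fun (`[0, +oo[ : set K) (fun t => s t i ord0)),
      locally_ess_bounded s
    & piecewise_right_continuous s].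

End Signals.

Section System.
Variables (K : realType) (n m q p : nat).
Implicit Types (X : set 'cV[K]_n) (U : set 'cV[K]_m) (W : set 'cV[K]_q).
Implicit Types (f : 'cV[K]_n * 'cV[K]_m * 'cV[K]_q -> 'cV[K]_n).
Implicit Types (h : 'cV[K]_n * 'cV[K]_m * 'cV[K]_q -> 'cV[K]_p).
Implicit Types (sol : 'cV[K]_n -> (K -> 'cV[K]_m) -> (K -> 'cV[K]_q) ->
                      K -> 'cV[K]_n).

Local Notation mu := (@lebesgue_measure K).

(* Carathéodory solution on [0, +oo) with values in [X], in integral form;
   it is locally absolutely continuous, and satisfies the differential equation
   almost everywhere and the initial condition x 0 = chi. *)
Definition is_solution X f (chi : 'cV[K]_n) (u : K -> 'cV[K]_m)
    (w : K -> 'cV[K]_q) (x : K -> 'cV[K]_n) : Prop :=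
  (forall t : K, 0 <= t -> X (x t)) /\
  (forall (t : K) i, 0 <= t ->
     mu.-integrable `[0, t] (EFin \o fun s => f (x s, u s, w s) i ord0) /\
     x t i ord0 =
       chi i ord0 + \int[mu]_(s in `[0, t]) (f (x s, u s, w s) i ord0)).

(* [sol chi u w t] is the solution written x(t, chi, u, w). *)
Definition solution_map X U W f sol : Prop :=
  forall chi u w, X chi -> admissible U u -> admissible W w ->
    is_solution X f chi u w (sol chi u w) /\
    (forall x, is_solution X f chi u w x ->
       forall t : K, 0 <= t -> x t = sol chi u w t).

(* [A], [E], [B] are the partial derivatives of [f] with respect to x, u, w. *)
Definition C1_on X U W f
    (A : 'cV[K]_n * 'cV[K]_m * 'cV[K]_q -> 'M[K]_n)
    (E : 'cV[K]_n * 'cV[K]_m * 'cV[K]_q -> 'M[K]_(n, m))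
    (B : 'cV[K]_n * 'cV[K]_m * 'cV[K]_q -> 'M[K]_(n, q)) : Prop :=
  [/\ {within X `*` U `*` W, continuous A},
      {within X `*` U `*` W, continuous E},
      {within X `*` U `*` W, continuous B}
    & forall z, (X `*` U `*` W) z ->
        is_derivative_within (X `*` U `*` W) f z
          (fun d => A z *m d.1.1 + E z *m d.1.2 + B z *m d.2)].

Definition affine_in_xw X U W h : Prop :=
  forall u, U u -> exists (M : 'M[K]_(p, n)) (N : 'M[K]_(p, q)) (c : 'cV[K]_p),
    forall x w, X x -> W w -> h (x, u, w) = M *m x + N *m w + c.

(* [C], [D] are the partial derivatives of [h] with respect to x and w. *)
Definition partials_xw X U W h
    (C : 'cV[K]_n * 'cV[K]_m * 'cV[K]_q -> 'M[K]_(p, n))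
    (D : 'cV[K]_n * 'cV[K]_m * 'cV[K]_q -> 'M[K]_(p, q)) : Prop :=
  forall x u w, X x -> U u -> W w ->
    is_derivative_within (X `*` W) (fun v => h (v.1, u, v.2)) (x, w)
      (fun d => C (x, u, w) *m d.1 + D (x, u, w) *m d.2).

(* The integral is extended-real valued: it is +oo when the nonnegative
   integrand is not integrable. *)
Definition dissipative X U W h sol (V : 'cV[K]_n * 'cV[K]_n -> K) (lambda : K)
    (gw : 'cV[K]_q -> K) (gy : 'cV[K]_p -> K) : Prop :=
  forall (t : K) chi1 chi2 u w1 w2, 0 <= t -> X chi1 -> X chi2 ->
    admissible U u -> admissible W w1 -> admissible W w2 ->
    let x1 := sol chi1 u w1 in
    let x2 := sol chi2 u w2 in
    let y1 := fun s => h (x1 s, u s, w1 s) in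
    let y2 := fun s => h (x2 s, u s, w2 s) in
    ((V (x1 t, x2 t))%:E <=
       (V (chi1, chi2) * lambda `^ t)%:E +
       \int[mu]_(s in `[0%R, t])
         (lambda `^ (t - s) * (gw (w1 s - w2 s) + gy (y1 s - y2 s)))%:E)%E.

Definition iiIOSS_Lyapunov X U W h sol (V : 'cV[K]_n * 'cV[K]_n -> K) : Prop :=
  [/\ {within X `*` X, continuous V},
      (forall chi1 chi2, X chi1 -> X chi2 -> 0 <= V (chi1, chi2))
    & exists (alpha1 alpha2 sigmaw sigmay : K -> K) (lambda : K),
        [/\ [/\ class_Kinf alpha1, class_Kinf alpha2,
                class_Kinf sigmaw & class_Kinf sigmay],
            0 <= lambda < 1,
            (forall chi1 chi2, X chi1 -> X chi2 ->
               alpha1 (enorm (chi1 - chi2)) <= V (chi1, chi2) <=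
               alpha2 (enorm (chi1 - chi2)))
          & dissipative X U W h sol V lambda
              (fun v => sigmaw (enorm v)) (fun v => sigmay (enorm v))]].

End System.

(* Main.v *)
(* For two points of X and of W, the segment joining them stays in X x W, and f
   is differentiable along it; since h is affine, [C dx + D dw] is constantly
   [y1 - y2] along it.  Testing the matrix inequality with [(dx, dw)] and
   applying the mean value theorem yields the pointwise inequality
     [2 (x1 - x2)^T P (f1 - f2) <=
        - kappa |x1 - x2|_P^2 + |w1 - w2|_Q^2 + |y1 - y2|_R^2].
   Along two solutions, [e^(- kappa (T - t)) |x1(t) - x2(t)|_P^2] minus the
   integral of the discounted supply rate over [0, t] is continuous on [0, T]
   and, away from the finitely many discontinuities of the inputs,
   differentiable with nonpositive derivative; it is therefore nonincreasing.
   The class-Kinf bounds come from the equivalence of the P-, Q-, R-norms with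
   the Euclidean one. *)
Require Import Defs.
From mathcomp Require Import all_boot all_order all_algebra.
From mathcomp Require Import all_classical all_reals all_analysis.
From mathcomp Require Import measurable_realfun ring lra.

Set Implicit Arguments.
Unset Strict Implicit.

Import Order.TTheory GRing.Theory Num.Theory.
Import numFieldNormedType.Exports.

Local Open Scope classical_set_scope.
Local Open Scope ring_scope.

(** * Bilinear and quadratic forms of matrices *)

Section BilinearForms.
Context {K : realType} {n m : nat}.
Implicit Types (M N : 'M[K]_(n, m)) (a : 'cV[K]_n) (b : 'cV[K]_m).

(** For square M and a = b this is convertible with [wsqnorm M a]; the rectangular case serves the
    off-diagonal blocks. *)
Definition bilin M a b : K := (a^T *m M *m b) ord0 ord0.

Lemma bilinDl M a a' b : bilin M (a + a') b = bilin M a b + bilin M a' b.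
Proof. by rewrite /bilin linearD/= !mulmxDl mxE. Qed.

Lemma bilinDr M a b b' : bilin M a (b + b') = bilin M a b + bilin M a b'.
Proof. by rewrite /bilin mulmxDr mxE. Qed.

Lemma bilinZl M k a b : bilin M (k *: a) b = k * bilin M a b.
Proof. by rewrite /bilin linearZ/= -!scalemxAl mxE. Qed.

Lemma bilinZr M k a b : bilin M a (k *: b) = k * bilin M a b.
Proof. by rewrite /bilin -!scalemxAr mxE. Qed.

Lemma bilin_addmx M N a b : bilin (M + N) a b = bilin M a b + bilin N a b.
Proof. by rewrite /bilin mulmxDr mulmxDl mxE. Qed.

Lemma bilin_scalemx k M a b : bilin (k *: M) a b = k * bilin M a b.
Proof. by rewrite /bilin -scalemxAr -scalemxAl mxE. Qed.

Lemma bilin_oppmx M a b : bilin (- M) a b = - bilin M a b.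
Proof. by rewrite -scaleN1r bilin_scalemx mulN1r. Qed.

Lemma bilinE M a b :
  bilin M a b = \sum_i \sum_j a i ord0 * M i j * b j ord0.
Proof.
rewrite /bilin !mxE exchange_big; apply: eq_bigr => j _ /=.
by rewrite !mxE mulr_suml; apply: eq_bigr => i _; rewrite !mxE.
Qed.

Lemma bilin_continuousl M b : continuous (fun a => bilin M a b).
Proof.
move=> v; rewrite /continuous_at bilinE.
rewrite (_ : (fun a => bilin M a b) =
  fun a => \sum_i \sum_j a i ord0 * M i j * b j ord0).
  apply: (@cvg_big _ _ _ _ _ add_continuous _ (nbhs v)) => i _.
  apply: (@cvg_big _ _ _ _ _ add_continuous _ (nbhs v)) => j _.
  apply: cvgM; last exact: cvg_cst.
  by apply: cvgM; [exact: coord_continuous|exact: cvg_cst].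
by apply/funext => a; rewrite -bilinE.
Qed.

End BilinearForms.

Lemma bilin_mulmxr (K : realType) n m r (M : 'M[K]_(n, m)) (N : 'M[K]_(m, r))
    a b : bilin (M *m N) a b = bilin M a (N *m b).
Proof. by rewrite /bilin !mulmxA. Qed.

Lemma bilin_mulmxl (K : realType) n m r (N : 'M[K]_(m, n)) (M : 'M[K]_(m, r))
    a b : bilin (N^T *m M) a b = bilin M (N *m a) b.
Proof. by rewrite /bilin trmx_mul !mulmxA. Qed.

Lemma wsqnorm_block (K : realType) n m (a : 'cV[K]_n) (b : 'cV[K]_m)
    (M11 : 'M[K]_n) (M12 : 'M[K]_(n, m)) (M21 : 'M[K]_(m, n)) (M22 : 'M[K]_m) :
  wsqnorm (block_mx M11 M12 M21 M22) (col_mx a b) =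
  bilin M11 a a + bilin M12 a b + (bilin M21 b a + bilin M22 b b).
Proof.
rewrite /wsqnorm tr_col_mx mul_row_block mul_row_col !mulmxDl.
rewrite mxE [X in X + _]mxE [X in _ + X]mxE -!/(bilin _ _ _); ring.
Qed.

(** * Comparison of weighted and Euclidean norms *)

Section QuadraticForms.
Context {K : realType} {n : nat}.
Implicit Types (M : 'M[K]_n) (a b v : 'cV[K]_n).

Lemma bilinC M a b : M^T = M -> bilin M a b = bilin M b a.
Proof.
move=> Msym; rewrite /bilin.
have -> : a^T *m M *m b = (b^T *m M *m a)^T.
  by rewrite !trmx_mul trmxK Msym mulmxA.
by rewrite mxE.
Qed.

Lemma wsqnormDZ M a b (k : K) : wsqnorm M (a + k *: b) =
  wsqnorm M a + k * (bilin M a b + bilin M b a) + k ^+ 2 * wsqnorm M b.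
Proof.
rewrite -![wsqnorm _ _]/(bilin _ _ _) bilinDl !bilinDr !bilinZl !bilinZr.
ring.
Qed.

Lemma wsqnorm0 M : wsqnorm M 0 = 0.
Proof. by rewrite /wsqnorm mulmx0 mxE. Qed.

Lemma sqr_enorm v : enorm v ^+ 2 = \sum_i v i ord0 ^+ 2.
Proof.
have E : (v^T *m v) ord0 ord0 = \sum_i v i ord0 ^+ 2.
  by rewrite mxE; apply: eq_bigr => i _; rewrite mxE expr2.
by rewrite /enorm E sqr_sqrtr// sumr_ge0// => i _; exact: sqr_ge0.
Qed.

Lemma sqr_enormE v : enorm v ^+ 2 = (v^T *m v) ord0 ord0.
Proof.
by rewrite sqr_enorm mxE; apply: eq_bigr => i _; rewrite mxE expr2.
Qed.

Lemma wsqnorm_le_sqr_enorm M :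
  exists2 c : K, 0 < c & forall v, wsqnorm M v <= c * enorm v ^+ 2.
Proof.
(* The summand 1 keeps the constant positive even for M = 0. *)
exists (1 + \sum_i \sum_j `|M i j|).
  by rewrite ltr_pwDl// sumr_ge0// => i _; rewrite sumr_ge0.
move=> v; rewrite -[wsqnorm _ _]/(bilin _ _ _) bilinE mulrDl mul1r.
apply: (@le_trans _ _ ((\sum_i \sum_j `|M i j|) * enorm v ^+ 2)); last first.
  by rewrite lerDr sqr_ge0.
have vle i : v i ord0 ^+ 2 <= enorm v ^+ 2.
  by rewrite sqr_enorm (bigD1 i)//= lerDl sumr_ge0// => j _; exact: sqr_ge0.
rewrite mulr_suml; apply: ler_sum => i _.
rewrite mulr_suml; apply: ler_sum => j _.
(* Each term is at most |M_ij| |v|^2, since 2 |v_i v_j| <= v_i^2 + v_j^2 <= 2 |v|^2. *)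
rewrite mulrAC mulrC (le_trans (ler_norm _))// normrM ler_wpM2l//.
rewrite ler_norml; have := vle i; have := vle j.
move: (v i ord0) (v j ord0) (enorm v ^+ 2) => x y z; nra.
Qed.

Lemma posdef_wsqnorm_ge0 M v : posdef M -> 0 <= wsqnorm M v.
Proof.
move=> [_ Mpos]; have [->|/Mpos/ltW//] := eqVneq v 0.
by rewrite wsqnorm0.
Qed.

(** A row of the left kernel of M, transposed, is a vector v with |v|_M^2 = 0, hence v = 0: the
    kernel is trivial. *)
Lemma posdef_unitmx M : posdef M -> M \in unitmx.
Proof.
move=> [Msym Mpos]; rewrite -row_free_unit -kermx_eq0.
apply/eqP/row_matrixP => i; rewrite row0.
apply/trmx_inj; rewrite trmx0; apply: contrapT => /eqP/Mpos.
rewrite /wsqnorm trmxK; have /sub_kermxP -> := row_sub i (kermx M).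
by rewrite mul0mx mxE ltxx.
Qed.

(* With [a = v - s M^-1 v], expanding [0 <= |a|_M^2] gives
   [2 s |v|^2 - s^2 |v|_(M^-1)^2 <= |v|_M^2]. *)
Lemma posdef_ge_sqr_enorm M : posdef M ->
  exists2 c : K, 0 < c & forall v, c * enorm v ^+ 2 <= wsqnorm M v.
Proof.
move=> Mpd; have Mu := posdef_unitmx Mpd; have [Msym _] := Mpd.
have [c c0 cP] := wsqnorm_le_sqr_enorm (invmx M).
(* Since |v|_(M^-1)^2 <= c |v|^2, the choice s = c^-1 makes 2 s |v|^2 - s^2 |v|_(M^-1)^2 at least
   c^-1 |v|^2. *)
exists c^-1; first by rewrite invr_gt0.
move=> v; set b := invmx M *m v.
have := posdef_wsqnorm_ge0 (v + (- c^-1) *: b) Mpd.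
rewrite wsqnormDZ (bilinC b v Msym).
have -> : bilin M v b = enorm v ^+ 2.
  by rewrite sqr_enormE /bilin /b mulmxA mulmxK.
have -> : wsqnorm M b = wsqnorm (invmx M) v.
  by rewrite /wsqnorm /b trmx_mul trmx_inv Msym -(mulmxA _ M) mulKVmx// mulmxA.
have : c^-1 ^+ 2 * wsqnorm (invmx M) v <= c^-1 * enorm v ^+ 2.
  apply: le_trans (ler_wpM2l (sqr_ge0 _) (cP v)) _.
  by rewrite expr2 mulrA mulfVK// gt_eqF.
rewrite sqrrN mulrDr !mulNr; lra.
Qed.

Lemma wsqnorm_continuous M : continuous (wsqnorm M).
Proof.
move=> v; rewrite /continuous_at.
rewrite (_ : wsqnorm M = fun a => \sum_i \sum_j a i ord0 * M i j * a j ord0).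
  apply: (@cvg_big _ _ _ _ _ add_continuous _ (nbhs v)) => i _.
  apply: (@cvg_big _ _ _ _ _ add_continuous _ (nbhs v)) => j _.
  apply: cvgM; last exact: coord_continuous.
  by apply: cvgM; [exact: coord_continuous|exact: cvg_cst].
by apply/funext => a; rewrite -bilinE.
Qed.

End QuadraticForms.

(** * Smoothness of the quadratic Lyapunov function *)

Section SmoothQuadratic.
Context {K : realType} {n : nat}.

(** The difference quotient at h != 0 is a + h b, which tends to a. With b = 0 this covers constant
    and affine functions too. *)
Lemma is_derive_quadratic (V : normedModType K) (g : V -> K) (z v : V) (a b : K) :
  (forall h : K, g (h *: v + z) = g z + h * a + h ^+ 2 * b) ->
  is_derive z v g a.
Proof.
move=> gE.
have dg : h^-1 *: (g (h *: v + z) - g z) @[h --> (0 : K)^'] --> a.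
  have : a + h * b @[h --> (0 : K)^'] --> a + 0 * b.
    apply: cvgD; first exact: cvg_cst.
    apply: cvgM; last exact: cvg_cst.
    exact: nbhs_dnbhs.
  rewrite mul0r addr0; apply: cvg_trans; apply: near_eq_cvg.
  near=> h; rewrite gE.
  have h0 : h != 0 by near: h; exact: nbhs_dnbhs_neq.
  by rewrite -[_ *: _]/(_ * _); field.
apply: DeriveDef; first by apply/cvg_ex; exists a.
exact: cvg_lim dg.
Unshelve. all: by end_near. Qed.

(** Directional derivatives of the quadratic form are linear in z.1 - z.2, those of a linear form
    are constant, those of a constant vanish; [Ck] is therefore established in the reverse order,
    for all k at each level. The derivative in direction v pairs z.1 - z.2 with v.1 - v.2 through
    both M and its transpose. *)
Lemma smooth_wsqnorm_sub (M : 'M[K]_n) :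
  smooth (fun z : 'cV[K]_n * 'cV[K]_n => wsqnorm M (z.1 - z.2)).
Proof.
have Ck_cst k : forall c : K, Ck k (fun _ : 'cV[K]_n * 'cV[K]_n => c).
  elim: k => [|k IHk] c; split=> //; try exact: cst_continuous.
  move=> v; have dc z : is_derive z v (fun _ : 'cV[K]_n * 'cV[K]_n => c) 0.
    by apply: (@is_derive_quadratic _ _ _ _ 0 0) => h; rewrite !mulr0 !addr0.
  split; first by move=> z; have [] := dc z.
  have -> : 'D_v (fun _ : 'cV[K]_n * 'cV[K]_n => c) = fun=> 0.
    by apply/funext => z; have [] := dc z.
  exact: IHk.
have subc : continuous (fun z : 'cV[K]_n * 'cV[K]_n => z.1 - z.2).
  by move=> z; apply: cvgB; [exact: cvg_fst|exact: cvg_snd].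
have subE (h : K) (z v : 'cV[K]_n * 'cV[K]_n) :
    (h *: v + z).1 - (h *: v + z).2 = (z.1 - z.2) + h *: (v.1 - v.2).
  by rewrite /= scalerBr opprD addrACA addrC.
have Ck_lin k : forall b, Ck k (fun z : 'cV[K]_n * 'cV[K]_n =>
    bilin M (z.1 - z.2) b + bilin M^T (z.1 - z.2) b).
  move=> b; have lc : continuous (fun z : 'cV[K]_n * 'cV[K]_n =>
      bilin M (z.1 - z.2) b + bilin M^T (z.1 - z.2) b).
    move=> z; apply: cvgD.
      exact: (continuous_comp (subc z) (@bilin_continuousl _ _ _ M b _)).
    exact: (continuous_comp (subc z) (@bilin_continuousl _ _ _ M^T b _)).
  case: k => [|k]; split=> // v.
  set c := bilin M (v.1 - v.2) b + bilin M^T (v.1 - v.2) b.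
  have dl z : is_derive z v (fun z : 'cV[K]_n * 'cV[K]_n =>
      bilin M (z.1 - z.2) b + bilin M^T (z.1 - z.2) b) c.
    apply: (@is_derive_quadratic _ _ _ _ c 0) => h.
    by rewrite subE !bilinDl !bilinZl /c; ring.
  split; first by move=> z; have [] := dl z.
  have -> : 'D_v (fun z : 'cV[K]_n * 'cV[K]_n =>
      bilin M (z.1 - z.2) b + bilin M^T (z.1 - z.2) b) = fun=> c.
    by apply/funext => z; have [] := dl z.
  exact: Ck_cst.
have bT a b : bilin M^T a b = bilin M b a.
  by rewrite /bilin -trmx_mul -[in LHS](trmxK b) -trmx_mul mxE mulmxA.
have Vc : continuous (fun z : 'cV[K]_n * 'cV[K]_n => wsqnorm M (z.1 - z.2)).
  move=> z; exact: (continuous_comp (subc z) (@wsqnorm_continuous _ _ M _)).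
case=> [|k]; split=> // v.
have dV z : is_derive z v (fun z : 'cV[K]_n * 'cV[K]_n => wsqnorm M (z.1 - z.2))
    (bilin M (z.1 - z.2) (v.1 - v.2) + bilin M^T (z.1 - z.2) (v.1 - v.2)).
  apply: (@is_derive_quadratic _ _ _ _ _ (wsqnorm M (v.1 - v.2))) => h.
  by rewrite subE wsqnormDZ bT.
split; first by move=> z; have [] := dV z.
have -> : 'D_v (fun z : 'cV[K]_n * 'cV[K]_n => wsqnorm M (z.1 - z.2)) =
    (fun z : 'cV[K]_n * 'cV[K]_n =>
      bilin M (z.1 - z.2) (v.1 - v.2) + bilin M^T (z.1 - z.2) (v.1 - v.2)).
  by apply/funext => z; have [] := dV z.
exact: Ck_lin.
Qed.

End SmoothQuadratic.

(** * Continuity and derivatives relative to a set *)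

(** Intended for f and h, which are continuous only relative to X x U x W: along paths staying in
    that set, limits still pass through them. *)
Lemma within_continuous_cvg_comp (T : Type) (X Y : topologicalType)
    (F : set_system T) (g : T -> X) (k : X -> Y) (S : set X) (z : X) :
  Filter F -> {within S, continuous k} -> S z -> g @ F --> z ->
  (\forall s \near F, S (g s)) -> k (g s) @[s --> F] --> k z.
Proof.
move=> FF /(_ z) kz Sz gz Sg A /kz /=.
rewrite /nbhs/= -nbhs_subspace_in// => /gz gA.
rewrite /fmap/=; near=> s.
have : S (g s) by near: s.
by near: s; exact: gA.
Unshelve. all: by end_near. Qed.

Lemma convex_set_segment (K : realType) (V : lmodType K) (X : set V) x y (s : K) :
  convex_set X -> X x -> X y ->
  0 <= s <= 1 -> X (s *: (x - y) + y).
Proof.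
move=> Xc Xx Xy /andP[s0 s1].
have := Xc x y (Itv01 s0 s1) (mem_set Xx) (mem_set Xy).
rewrite inE; congr X; rewrite -[LHS]/(s *: x + (1 - s) *: y).
by rewrite scalerBl scale1r scalerBr addrA addrAC.
Qed.

(** Small increments h d stay in S, so the estimate defining the relative derivative applies to
    them; divided by |h|, it bounds the error of the difference quotient. *)
Lemma is_derivative_within_is_derive (K : realType) (V W : normedModType K)
    (S : set V) (g L : V -> W) (z d : V) :
  is_derivative_within S g z L -> (forall h : K, L (h *: d) = h *: L d) ->
  (\forall h \near (0 : K), S (h *: d + z)) -> is_derive z d g (L d).
Proof.
move=> gL Lh Sd.
have zd : h *: d + z @[h --> (0 : K)] --> z.
  rewrite -[X in _ --> X]add0r -[X in _ --> X + _](scale0r d).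
  by apply: cvgD; [exact: (cvgZ cvg_id (cvg_cst d))|exact: cvg_cst].
have dg : h^-1 *: (g (h *: d + z) - g z) @[h --> (0 : K)^'] --> L d.
  apply/cvgrPdist_le => e e0.
  (* Multiplied by |d|, this tolerance stays below e; the added 1 covers d = 0. *)
  have e'0 : 0 < e / (`|d| + 1) by rewrite divr_gt0// ltr_wpDl.
  near=> h.
  have h0 : h != 0 by near: h; exact: nbhs_dnbhs_neq.
  have : `|g (h *: d + z) - g z - L (h *: d + z - z)| <=
      e / (`|d| + 1) * `|h *: d + z - z|.
    have : S (h *: d + z) by near: h; exact: nbhs_dnbhs.
    by near: h; apply: nbhs_dnbhs; exact: zd _ (gL _ e'0).
  rewrite addrK Lh normrZ => gh.
  have -> : L d - h^-1 *: (g (h *: d + z) - g z) =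
      (- h^-1) *: (g (h *: d + z) - g z - h *: L d).
    move: (g _ - _) => a; by rewrite scalerBr !scaleNr opprK scalerK// addrC.
  rewrite normrZ normrN normfV -ler_pdivlMl ?invr_gt0 ?normr_gt0// invrK.
  apply: (le_trans gh); rewrite mulrCA ler_wpM2l//.
  by rewrite mulrAC ler_pdivrMr ?ltr_wpDl// ler_wpM2l ?(ltW e0)// lerDl.
apply: DeriveDef; first by apply/cvg_ex; exists (L d).
exact: cvg_lim dg.
Unshelve. all: by end_near. Qed.

(** Both derivatives are limits of the same difference quotient: an increment h of s moves the point
    on the line by h d. *)
Lemma is_derive_line (K : realType) (V W : normedModType K) (g : V -> W)
    (z d : V) (l : W) (s : K) :
  is_derive (s *: d + z) d g l -> is_derive s 1 (fun s => g (s *: d + z)) l.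
Proof.
move=> [dg <-].
have E : (fun h : K => h^-1 *:
    (((fun s => g (s *: d + z)) \o shift s) (h *: (1 : K)) - g (s *: d + z))) =
  (fun h => h^-1 *: ((g \o shift (s *: d + z)) (h *: d) - g (s *: d + z))).
  by apply/funext => h; rewrite /= scalerDl -addrA -[h *: 1]/(h * 1) mulr1.
by apply: DeriveDef; rewrite /derivable /derive E.
Qed.

Lemma is_derive_bilinl (K : realType) (V : normedModType K) n
    (F : V -> 'cV[K]_n) (M : 'M[K]_n) (b : 'cV[K]_n) z d l :
  is_derive z d F l -> is_derive z d (fun x => bilin M (F x) b) (bilin M l b).
Proof.
move=> [dF Fl].
have dg : h^-1 *: (bilin M (F (h *: d + z)) b - bilin M (F z) b)
    @[h --> (0 : K)^'] --> bilin M l b.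
  have -> : (fun h : K =>
        h^-1 *: (bilin M (F (h *: d + z)) b - bilin M (F z) b)) =
      (fun h => bilin M (h^-1 *: (F (h *: d + z) - F z)) b).
    apply/funext => h; rewrite [RHS](bilinZl M) (bilinDl M).
    by rewrite -[- F z]scaleN1r (bilinZl M) mulN1r.
  apply: (@cvg_comp _ _ _ _ (fun a => bilin M a b) _ (nbhs l)).
    rewrite -Fl; exact: dF.
  exact: bilin_continuousl.
apply: DeriveDef; first by apply/cvg_ex; exists (bilin M l b).
exact: cvg_lim dg.
Qed.

(** * The pointwise dissipation inequality *)

(** Evaluated at (a, b), the block form is 2 a^T P (A a + B b) + kappa |a|_P^2 - |b|_Q^2 - |C a + D
    b|_R^2; the symmetry of P and R merges the mixed terms. *)
Lemma lmi_quadratic (K : realType) n q p (P A : 'M[K]_n) (B : 'M[K]_(n, q))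
    (C : 'M[K]_(p, n)) (D : 'M[K]_(p, q)) (Q : 'M[K]_q) (R : 'M[K]_p) kappa a b :
  P^T = P -> R^T = R ->
  negsemidef (block_mx (P *m A + A^T *m P + kappa *: P - C^T *m R *m C)
    (P *m B - C^T *m R *m D) (B^T *m P - D^T *m R *m C)
    (- (D^T *m R *m D) - Q)) ->
  2 * bilin P (A *m a + B *m b) a <=
  - kappa * wsqnorm P a + wsqnorm Q b + wsqnorm R (C *m a + D *m b).
Proof.
move=> Psym Rsym [_ /(_ (col_mx a b))].
rewrite wsqnorm_block -![wsqnorm _ _]/(bilin _ _ _).
rewrite !(bilin_addmx, bilin_scalemx, bilin_oppmx).
rewrite -!mulmxA.
rewrite !(bilin_mulmxl A, bilin_mulmxl B, bilin_mulmxl C, bilin_mulmxl D).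
rewrite !bilin_mulmxr !bilinDl !bilinDr.
rewrite !(bilinC a _ Psym) (bilinC (D *m b) (C *m a) Rsym); lra.
Qed.

Lemma lmi_dissipation (K : realType) n m q p
    (X : set 'cV[K]_n) (U : set 'cV[K]_m) (W : set 'cV[K]_q)
    (f : 'cV[K]_n * 'cV[K]_m * 'cV[K]_q -> 'cV[K]_n)
    (h : 'cV[K]_n * 'cV[K]_m * 'cV[K]_q -> 'cV[K]_p)
    (A : 'cV[K]_n * 'cV[K]_m * 'cV[K]_q -> 'M[K]_n)
    (E : 'cV[K]_n * 'cV[K]_m * 'cV[K]_q -> 'M[K]_(n, m))
    (B : 'cV[K]_n * 'cV[K]_m * 'cV[K]_q -> 'M[K]_(n, q))
    (C : 'cV[K]_n * 'cV[K]_m * 'cV[K]_q -> 'M[K]_(p, n))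
    (D : 'cV[K]_n * 'cV[K]_m * 'cV[K]_q -> 'M[K]_(p, q))
    (P : 'M[K]_n) (Q : 'M[K]_q) (R : 'M[K]_p) (kappa : K) x1 x2 u w1 w2 :
  {within X `*` U `*` W, continuous f} -> C1_on X U W f A E B ->
  affine_in_xw X U W h -> partials_xw X U W h C D ->
  convex_set X -> convex_set W -> P^T = P -> R^T = R ->
  (forall z, (X `*` U `*` W) z ->
     negsemidef
       (block_mx
          (P *m A z + (A z)^T *m P + kappa *: P - (C z)^T *m R *m C z)
          (P *m B z - (C z)^T *m R *m D z)
          ((B z)^T *m P - (D z)^T *m R *m C z)
          (- ((D z)^T *m R *m D z) - Q))) ->
  X x1 -> X x2 -> U u -> W w1 -> W w2 ->
  2 * bilin P (f (x1, u, w1) - f (x2, u, w2)) (x1 - x2) <=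
  - kappa * wsqnorm P (x1 - x2) + wsqnorm Q (w1 - w2) +
  wsqnorm R (h (x1, u, w1) - h (x2, u, w2)).
Proof.
move=> fc [_ _ _ fd] haff hd Xc Wc Psym Rsym lmi Xx1 Xx2 Uu Ww1 Ww2.
(* Both points share the input u, so the segment moves only in x and w, where convexity keeps it in
   the set. *)
pose d : 'cV[K]_n * 'cV[K]_m * 'cV[K]_q := (x1 - x2, 0, w1 - w2).
pose z2 : 'cV[K]_n * 'cV[K]_m * 'cV[K]_q := (x2, u, w2).
have zE (s : K) :
    s *: d + z2 = (s *: (x1 - x2) + x2, u, s *: (w1 - w2) + w2).
  rewrite /d /z2 -[LHS]/(s *: (x1 - x2) + x2, s *: 0 + u, s *: (w1 - w2) + w2).
  by rewrite scaler0 add0r.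
have Sz (s : K) : 0 <= s <= 1 -> (X `*` U `*` W) (s *: d + z2).
  by move=> s01; rewrite zE; split; [split=> //=|]; apply: convex_set_segment.
have oo01 (s : K) : s \in `]0, 1[ -> 0 <= s <= 1.
  by rewrite in_itv/= => /andP[]; lra.
(* Derivatives are taken only at interior parameters, where small increments of both signs stay on
   the segment. *)
have near01 (s : K) : s \in `]0, 1[ -> \forall k \near (0 : K), 0 <= s + k <= 1.
  rewrite in_itv/= => /andP[s0 s1].
  have e0 : 0 < Num.min s (1 - s) by rewrite lt_min s0 subr_gt0.
  near=> k; have : `|k| < Num.min s (1 - s).
    by near: k; exact: (@nbhs0_lt K K^o _ e0).
  by rewrite lt_min !ltr_norml => /andP[/andP[? ?] /andP[? ?]]; lra.
(* Pairing with the fixed vector P (x1 - x2) makes the map scalar, as the mean value theorem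
   requires. *)
pose phi (s : K) := bilin P (f (s *: d + z2)) (x1 - x2).
pose dphi (s : K) := bilin P
  (A (s *: d + z2) *m (x1 - x2) + B (s *: d + z2) *m (w1 - w2)) (x1 - x2).
have phi' (s : K) : s \in `]0, 1[ -> is_derive s 1 phi (dphi s).
  move=> s01; apply: (@is_derive_line _ _ _ (fun z => bilin P (f z) (x1 - x2))).
  apply: is_derive_bilinl.
  have -> : A (s *: d + z2) *m (x1 - x2) + B (s *: d + z2) *m (w1 - w2) =
      A (s *: d + z2) *m d.1.1 + E (s *: d + z2) *m d.1.2 +
      B (s *: d + z2) *m d.2 by rewrite mulmx0 addr0.
  apply: (is_derivative_within_is_derive (fd _ (Sz _ (oo01 _ s01)))) => [k|].
    by rewrite /= -!scalemxAr !scalerDr.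
  near=> k; rewrite addrA -scalerDl; apply: Sz; rewrite addrC.
  by near: k; exact: near01.
have phic : {within `[0, 1], continuous phi}.
  apply/subspace_continuousP => s s01; rewrite /phi.
  apply: (@cvg_comp _ _ _ _ (fun a => bilin P a (x1 - x2)) _
    (nbhs (f (s *: d + z2)))); last exact: bilin_continuousl.
  apply: (@within_continuous_cvg_comp _ _ _ _ (fun t : K => t *: d + z2) f _ _ _ fc).
  - by apply: Sz; move: s01; rewrite /= in_itv.
  - apply: cvg_within_filter; apply: cvgD; last exact: cvg_cst.
    by apply: cvgZ; [exact: cvg_id|exact: cvg_cst].
  - near=> t; apply: Sz.
    suff : `[0%R, 1%R]%classic t by rewrite /= in_itv.
    by near: t; exact: withinT.
(* X x W may have empty interior, so C and D need not coincide with the matrices M and N of the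
   affine formula. Their action on the direction (x1 - x2, w1 - w2) is nevertheless determined: the
   directional derivative is computed once from C and D, once from the affine formula. *)
have hE (s : K) : s \in `]0, 1[ -> h (x1, u, w1) - h (x2, u, w2) =
    C (s *: d + z2) *m (x1 - x2) + D (s *: d + z2) *m (w1 - w2).
  move=> s01; have [M [N [c hMN]]] := haff u Uu.
  pose d' := (x1 - x2, w1 - w2).
  pose z' := (s *: (x1 - x2) + x2, s *: (w1 - w2) + w2).
  pose G (v : 'cV[K]_n * 'cV[K]_q) := h (v.1, u, v.2).
  have Xz (t : K) : 0 <= t <= 1 -> X (t *: (x1 - x2) + x2).
    by move=> t01; exact: convex_set_segment.
  have Wz (t : K) : 0 <= t <= 1 -> W (t *: (w1 - w2) + w2).
    by move=> t01; exact: convex_set_segment.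
  have near_line : \forall k \near (0 : K), (X `*` W) (k *: d' + z').
    near=> k.
    have sk01 : 0 <= k + s <= 1 by rewrite addrC; near: k; exact: near01.
    by split=> /=; rewrite addrA -scalerDl; [exact: Xz|exact: Wz].
  have D1 : is_derive z' d' G
      (C (s *: d + z2) *m (x1 - x2) + D (s *: d + z2) *m (w1 - w2)).
    rewrite zE.
    apply: (is_derivative_within_is_derive (d := d')
      (hd _ _ _ (Xz _ (oo01 _ s01)) Uu (Wz _ (oo01 _ s01)))) => // k.
    by rewrite /= -!scalemxAr !scalerDr.
  have D2 : is_derive z' d' G (h (x1, u, w1) - h (x2, u, w2)).
    have dG : k^-1 *: (G (k *: d' + z') - G z') @[k --> (0 : K)^'] -->
        h (x1, u, w1) - h (x2, u, w2).
      apply: cvg_near_cst; near=> k.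
      have k0 : k != 0 by near: k; exact: nbhs_dnbhs_neq.
      have [Xk Wk] : (X `*` W) (k *: d' + z') by near: k; exact: nbhs_dnbhs.
      rewrite /G !hMN//; try exact: Xz (oo01 _ s01); try exact: Wz (oo01 _ s01).
      rewrite /= !(mulmxDr _ (k *: _)) -!scalemxAr -/d'.
      move: (M *m (s *: _ + _)) (N *m (s *: _ + _)) => a b.
      rewrite (addrACA (k *: _)) -scalerDr -(addrA (k *: _)) addrK.
      rewrite scalerK// !mulmxBr addrACA -opprD.
      by rewrite [in RHS]opprD [RHS]addrACA subrr addr0.
    apply: DeriveDef; first by apply/cvg_ex; eexists; exact: dG.
    exact: cvg_lim dG.
  by have [_ <-] := D1; have [_ ->] := D2.
have [s s01] := MVT ltr01 phi' phic.
rewrite subr0 mulr1 => phiE.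
have -> : bilin P (f (x1, u, w1) - f (x2, u, w2)) (x1 - x2) = dphi s.
  rewrite -phiE /phi !zE !scale1r !scale0r !subrK !add0r.
  by rewrite -[- f (x2, u, w2)]scaleN1r (bilinDl P) (bilinZl P) mulN1r.
rewrite (hE _ s01); apply: lmi_quadratic => //.
exact: lmi _ (Sz _ (oo01 _ s01)).
Unshelve. all: by end_near. Qed.

(** * Finitely many exceptional points *)

(** Induction on the exceptional points: one inside the interval splits it in two, and continuity on
    the closed pieces joins the two inequalities; one outside is discarded. *)
Lemma le_of_derive1_le0_except (K : realType) (g : K -> K) (s : seq K) (a b : K) :
  a <= b -> {within `[a, b], continuous g} ->
  (forall t, t \in `]a, b[ -> t \notin s ->
     exists2 l, is_derive t 1 g l & l <= 0) ->
  g b <= g a.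
Proof.
elim: s a b => [|c s IHs] a b ab gc g'.
  apply: (@ler0_derive1_nincr _ g a b) => // t /g'/(_ isT)[l [? gl] l0] //.
  by rewrite derive1E gl.
have [|cab] := boolP (c \in `]a, b[); last first.
  apply: IHs => // t tab ts; apply: g' => //; rewrite inE negb_or ts andbT.
  by apply: contraNneq cab => <-.
rewrite in_itv/= => /andP[ac cb]; apply: (@le_trans _ _ (g c)).
- apply: IHs; first exact: ltW.
    by apply: continuous_subspaceW gc; apply: subset_itvr; rewrite bnd_simp ltW.
  move=> t; rewrite in_itv/= => /andP[ct tb] ts; apply: g'.
    by rewrite in_itv/= tb (lt_trans ac).
  by rewrite inE negb_or ts gt_eqF.
- apply: IHs; first exact: ltW.
    by apply: continuous_subspaceW gc; apply: subset_itvl; rewrite bnd_simp ltW.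
  move=> t; rewrite in_itv/= => /andP[at_ tc] ts; apply: g'.
    by rewrite in_itv/= at_ (lt_trans tc).
  by rewrite inE negb_or ts lt_eqF.
Qed.

(** By the same splitting: on a piece with no exceptional point inside, continuity on the open
    interval gives measurability there, and adding the endpoints preserves it. *)
Lemma measurable_fun_continuous_except (K : realType) (g : K -> K) (s : seq K)
    (a b : K) : a <= b ->
  (forall t, t \in `]a, b[ -> t \notin s -> {for t, continuous g}) ->
  measurable_fun `[a, b] g.
Proof.
elim: s a b => [|c s IHs] a b ab gc.
  apply: (@measurable_fun_itv_cc _ _ _ false true).
  apply: open_continuous_measurable_fun; first exact: interval_open.
  by move=> t; rewrite inE/= => tab; exact: gc.
have [|cab] := boolP (c \in `]a, b[); last first.
  apply: IHs => // t tab ts; apply: gc => //; rewrite inE negb_or ts andbT.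
  by apply: contraNneq cab => <-.
rewrite in_itv/= => /andP[ac cb].
have -> : `[a, b]%classic = `[a, c] `|` `[c, b].
  apply/seteqP; split => [t|t []]; rewrite /= !in_itv/= => /andP[ta tb].
  - by rewrite ta tb andbT; exact/orP/le_total.
  - by rewrite ta (le_trans tb (ltW cb)).
  - by rewrite tb (le_trans (ltW ac) ta).
apply/measurable_funU => //; split; apply: IHs; try exact: ltW.
- move=> t; rewrite in_itv/= => /andP[at_ tc] ts; apply: gc.
    by rewrite in_itv/= at_ (lt_trans tc).
  by rewrite inE negb_or ts lt_eqF.
- move=> t; rewrite in_itv/= => /andP[ct tb] ts; apply: gc.
    by rewrite in_itv/= tb (lt_trans ac).
  by rewrite inE negb_or ts gt_eqF.
Qed.

Lemma cvg_matrix (K : realType) (T : Type) n m (F : set_system T)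
    (M : T -> 'M[K]_(n, m)) (L : 'M[K]_(n, m)) : Filter F ->
  (forall i j, M t i j @[t --> F] --> L i j) -> M @ F --> L.
Proof.
move=> FF ML A [N NL NA]; rewrite /= /fmap/=.
have : \forall t \near F, forall i j, N i j (M t i j).
  apply: filter_forall => i; apply: filter_forall => j.
  exact: ML (NL i j).
by apply: filterS => t tN; exact: NA.
Qed.

(** * Integral curves and the integrated dissipation inequality *)

Lemma integral_curve_continuous (K : realType) (phi g : K -> K) (c T : K) :
  lebesgue_measure.-integrable `[0, T] (EFin \o g) ->
  (forall t, 0 <= t <= T ->
     phi t = c + \int[lebesgue_measure]_(s in `[0, t]) g s) ->
  0 <= T -> {within `[0, T], continuous phi}.
Proof.
move=> g_int phiE T0; have G_cont : {within `[0, T], continuous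
    (fun t => c + \int[lebesgue_measure]_(s in `[0, t]) g s)}.
  move=> t; apply: cvgD; first exact: cvg_cst.
  exact: (parameterized_integral_continuous T0 g_int).
apply: subspace_eq_continuous G_cont => t.
by rewrite inE/= in_itv/= => tT; rewrite [RHS]phiE.
Qed.

(** The fundamental theorem of calculus at a continuity point of the integrand; since t is interior,
    [phi] agrees with the integral in a neighbourhood of t. *)
Lemma integral_curve_derive (K : realType) (phi g : K -> K) (c T t : K) :
  lebesgue_measure.-integrable `[0, T] (EFin \o g) ->
  (forall t, 0 <= t <= T ->
     phi t = c + \int[lebesgue_measure]_(s in `[0, t]) g s) ->
  0 < t < T -> {for t, continuous g} -> is_derive t 1 phi (g t).
Proof.
move=> g_int phiE /andP[t0 tT] gt.
have [dG G'] := continuous_FTC1_closed tT g_int t0 gt.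
have dcG : is_derive t 1
    (fun t => c + \int[lebesgue_measure]_(s in `[0, t]) g s) (0 + g t).
  apply: is_deriveD; apply: DeriveDef => //.
  by rewrite -derive1E.
rewrite add0r in dcG.
apply: near_eq_is_derive dcG.
near=> s; rewrite phiE//.
have : s \in `]0, T[ by near: s; apply: near_in_itvoo; rewrite in_itv/= t0.
by rewrite in_itv/=; lra.
Unshelve. all: by end_near. Qed.

(** Product rule entry by entry; the symmetry of M merges the two resulting sums into twice one
    bilinear form. *)
Lemma is_derive_wsqnorm (K : realType) n (M : 'M[K]_n) (d : K -> 'cV[K]_n)
    (t : K) (l : 'cV[K]_n) : M^T = M ->
  (forall i, is_derive t 1 (fun s => d s i ord0) (l i ord0)) ->
  is_derive t 1 (fun s => wsqnorm M (d s)) (2 * bilin M l (d t)).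
Proof.
move=> Msym dd.
have -> : (fun s => wsqnorm M (d s)) =
    \sum_(i < n) \sum_(j < n) (fun s => d s i ord0 * M i j * d s j ord0).
  apply/funext => s; rewrite fct_sumE -[LHS]/(bilin _ _ _) bilinE.
  by apply: eq_bigr => i _; rewrite fct_sumE.
have -> : 2 * bilin M l (d t) = \sum_(i < n) \sum_(j < n)
    ((d t i ord0 * M i j) * l j ord0 + d t j ord0 * (M i j * l i ord0)).
  rewrite mulr_natl mulr2n {1}(bilinC _ _ Msym) !bilinE -big_split.
  apply: eq_bigr => i _; rewrite -big_split; apply: eq_bigr => j _ /=; ring.
apply: is_derive_sum => i; apply: is_derive_sum => j.
have d1 : is_derive t 1 (fun s => d s i ord0 * M i j) (M i j * l i ord0).
  have -> : (fun s => d s i ord0 * M i j) = M i j \*: (fun s => d s i ord0).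
    by apply/funext => s; rewrite /= mulrC.
  exact: is_deriveZ.
exact: (is_deriveM d1 (dd j)).
Qed.

(** Here d stands for the difference of two solutions, g for that of their velocities, r for the
    supply rate, and s lists the times where continuity of r or g may fail. *)
Lemma integral_dissipation (K : realType) n (P : 'M[K]_n) (kappa T : K)
    (d g : K -> 'cV[K]_n) (c : 'cV[K]_n) (r : K -> K) (s : seq K) :
  P^T = P -> 0 <= T ->
  (forall i, lebesgue_measure.-integrable `[0, T]
     (EFin \o fun t => g t i ord0)) ->
  (forall t i, 0 <= t <= T ->
     d t i ord0 = c i ord0 + \int[lebesgue_measure]_(s in `[0, t]) g s i ord0) ->
  (forall t, t \in `]0, T[ -> t \notin s ->
     {for t, continuous r} /\ forall i, {for t, continuous (fun t => g t i ord0)}) ->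
  (forall t, 0 <= t <= T -> 0 <= r t) ->
  (forall t, t \in `]0, T[ ->
     2 * bilin P (g t) (d t) <= - kappa * wsqnorm P (d t) + r t) ->
  ((wsqnorm P (d T))%:E <=
     (wsqnorm P c * expR (- kappa) `^ T)%:E +
     \int[lebesgue_measure]_(t in `[0%R, T])
       (expR (- kappa) `^ (T - t) * r t)%:E)%E.
Proof.
move=> Psym T0 g_int dE gr_cont r0 d'le.
(* The discount lambda^(T - t) with lambda = e^(- kappa). Its derivative is kappa times itself,
   which compensates the decay term - kappa |d|_P^2, and its value at T is 1. *)
pose e (t : K) := expR (- kappa * (T - t)).
have eE t : expR (- kappa) `^ (T - t) = e t by rewrite -expRM.
have de (t : K) : is_derive t 1 e (kappa * e t).
  have dlin : is_derive t 1 (fun t => - kappa * (T - t)) kappa.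
    apply: (@is_derive_quadratic _ _ _ _ _ _ 0) => k.
    by rewrite -[k *: 1]/(k * 1); ring.
  rewrite mulrC; exact: (is_derive1_comp (is_derive_expR _) dlin).
have e_cont : continuous e.
  by move=> t; apply/differentiable_continuous/derivable1_diffP; have [] := de t.
have d0 : d 0 = c.
  apply/matrixP => i j; rewrite ord1 dE ?lexx ?T0//.
  by rewrite set_itv1 Rintegral_set1 addr0.
pose er t := e t * r t.
have er0 t : 0 <= t <= T -> 0 <= er t.
  by move=> tT; rewrite mulr_ge0 ?r0// expR_ge0.
have er_cont t : t \in `]0, T[ -> t \notin s -> {for t, continuous er}.
  move=> tT ts; have [rt _] := gr_cont t tT ts.
  by apply: cvgM; [exact: e_cont|exact: rt].
have er_meas : measurable_fun `[0, T] er.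
  exact: (measurable_fun_continuous_except T0 er_cont).
under eq_integral do rewrite eE -/(er _).
have int0 : (0 <= \int[lebesgue_measure]_(t in `[0%R, T]) (er t)%:E)%E.
  by apply: integral_ge0 => t; rewrite /= in_itv/= lee_fin; exact: er0.
(* If the discounted supply has infinite integral, the claim is trivial; otherwise it is integrable,
   being nonnegative and measurable. *)
have [int_oo|] :=
    ltP (\int[lebesgue_measure]_(t in `[0%R, T]) (er t)%:E)%E +oo%E; last first.
  by rewrite leye_eq => /eqP ->; rewrite addey// leey.
have er_int : lebesgue_measure.-integrable `[0, T] (EFin \o er).
  apply/integrableP; split; first exact/measurable_EFinP.
  apply: le_lt_trans int_oo.
  rewrite le_eqVlt; apply/orP; left; apply/eqP; apply: eq_integral => t.
  by rewrite inE/= in_itv/= => tT; rewrite ger0_norm// er0.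
have [T_eq0|T_neq0] := eqVneq T 0.
  rewrite T_eq0 d0 powRr0 mulr1 leeDl//.
  by move: int0; rewrite T_eq0.
have T_gt0 : 0 < T by rewrite lt_neqAle eq_sym T_neq0.
pose I t := \int[lebesgue_measure]_(s in `[0, t]) er s.
(* The leading 0 gives [I] the shape of a constant plus an integral, as for any integral curve. *)
have IE t : 0 <= t <= T -> I t = 0 + I t by rewrite add0r.
pose H t := e t * wsqnorm P (d t) - I t.
have H_cont : {within `[0, T], continuous H}.
  apply/subspace_continuousP => t tT; apply: cvgB.
    apply: cvgM; first by apply: cvg_within_filter; exact: e_cont.
    apply: (@cvg_comp _ _ _ _ (wsqnorm P) _ (nbhs (d t)));
      last exact: wsqnorm_continuous.
    apply: cvg_matrix => i j; rewrite ord1.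
    have := integral_curve_continuous (g_int i) (fun t tT => dE t i tT) T0.
    by move/subspace_continuousP/(_ t tT).
  have := integral_curve_continuous er_int IE T0.
  by move/subspace_continuousP/(_ t tT).
have H' t : t \in `]0, T[ -> t \notin s -> exists2 l, is_derive t 1 H l & l <= 0.
  move=> tT ts; have [_ gt] := gr_cont t tT ts.
  have tT' : 0 < t < T by move: tT; rewrite in_itv.
  have dI : is_derive t 1 I (er t).
    exact: (integral_curve_derive er_int IE tT' (er_cont t tT ts)).
  have dV : is_derive t 1 (fun t => wsqnorm P (d t)) (2 * bilin P (g t) (d t)).
    apply: is_derive_wsqnorm => // i.
    exact: (integral_curve_derive (g_int i) (fun t tT => dE t i tT) tT' (gt i)).
  (* This is e (2 bilin P g d + kappa |d|_P^2 - r), nonpositive by the assumed dissipation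
     inequality. *)
  exists (e t * (2 * bilin P (g t) (d t)) + wsqnorm P (d t) * (kappa * e t) - er t).
    exact: (is_deriveB (is_deriveM (de t) dV) dI).
  rewrite /er; have := d'le t tT; have : 0 <= e t by exact: expR_ge0.
  move: (bilin _ _ _) (wsqnorm _ _) (e t) (r t) => x y z w; nra.
have := le_of_derive1_le0_except T0 H_cont H'.
rewrite /H /I set_itv1 Rintegral_set1 subr0 d0.
have -> : e T = 1 by rewrite /e subrr mulr0 expR0.
(* Reading T as T - 0 turns lambda^T into [e 0], so that H T <= H 0 becomes the claim. *)
rewrite mul1r -[T in expR _ `^ T]subr0 eE => HT.
rewrite -[X in (_ + X)%E]fineK ?ge0_fin_numE// -EFinD lee_fin.
move: HT; rewrite /Rintegral; lra.
Qed.

(** * The dissipation inequality along solutions of the system *)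

Lemma is_solution_continuous (K : realType) n m q (X : set 'cV[K]_n)
    (f : 'cV[K]_n * 'cV[K]_m * 'cV[K]_q -> 'cV[K]_n) chi u w x (t : K) :
  is_solution X f chi u w x -> 0 < t -> {for t, continuous x}.
Proof.
move=> [_ xsol] t0; apply: cvg_matrix => i j; rewrite ord1.
(* The horizon t + 1 makes t interior, hence continuity from both sides. *)
have t10 : 0 <= t + 1 by rewrite addr_ge0// ltW.
have [fint _] := xsol _ i t10.
have xE s : 0 <= s <= t + 1 -> x s i ord0 = chi i ord0 +
    \int[lebesgue_measure]_(r in `[0, s]) f (x r, u r, w r) i ord0.
  by move=> /andP[s0 _]; have [] := xsol s i s0.
have := integral_curve_continuous fint xE t10.
move=> /continuous_within_itvP[|+ _ _]; first by rewrite ltr_wpDl// ltW.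
by apply; rewrite in_itv/= t0 ltrDl ltr01.
Qed.

(** For t > 0 the path lies in X x U x W at all times near t, so continuity of F relative to that
    set is enough. *)
Lemma continuous_along_solution (K : realType) n m q k
    (X : set 'cV[K]_n) (U : set 'cV[K]_m) (W : set 'cV[K]_q)
    (f : 'cV[K]_n * 'cV[K]_m * 'cV[K]_q -> 'cV[K]_n)
    (F : 'cV[K]_n * 'cV[K]_m * 'cV[K]_q -> 'cV[K]_k) chi u w x (t : K) :
  {within X `*` U `*` W, continuous F} -> is_solution X f chi u w x ->
  admissible U u -> admissible W w -> 0 < t ->
  {for t, continuous u} -> {for t, continuous w} ->
  {for t, continuous (fun s => F (x s, u s, w s))}.
Proof.
move=> Fc xsol [Uu _ _ _] [Ww _ _ _] t0 ut wt.
have [Xx _] := xsol.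
have S s : 0 <= s -> (X `*` U `*` W) (x s, u s, w s).
  by move=> s0; split; [split; [exact: Xx|exact: Uu]|exact: Ww].
apply: (@within_continuous_cvg_comp _ _ _ _ (fun s => (x s, u s, w s)) F _ _ _ Fc).
- by apply: S; exact: ltW.
- exact: (cvg_pair (cvg_pair (is_solution_continuous xsol t0) ut) wt).
- near=> s; apply: S; apply: ltW; near: s; exact: lt_nbhsr.
Unshelve. all: by end_near. Qed.

Lemma admissible_discontinuities (K : realType) k (S : set 'cV[K]_k)
    (v : K -> 'cV[K]_k) (T : K) : admissible S v ->
  exists s : seq K, forall t, t \in `]0, T[ -> t \notin s -> {for t, continuous v}.
Proof.
move=> [_ _ _ [_ /(_ T)/finite_seqP[s sE]]]; exists s => t.
rewrite in_itv/= => /andP[t0 tT] ts; apply: contrapT => vt.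
suff : [set` s] t by rewrite /= (negbTE ts).
by rewrite -sE; split=> //; rewrite t0 ltW.
Qed.

(** Stated for general supply rates because it is applied twice: with the Q- and R-weighted norms
    for the sharp estimate, and with multiples of squared Euclidean norms for the class-Kinf
    form. *)
Lemma dissipative_wsqnorm (K : realType) n m q p
    (X : set 'cV[K]_n) (U : set 'cV[K]_m) (W : set 'cV[K]_q)
    (f : 'cV[K]_n * 'cV[K]_m * 'cV[K]_q -> 'cV[K]_n)
    (h : 'cV[K]_n * 'cV[K]_m * 'cV[K]_q -> 'cV[K]_p)
    (sol : 'cV[K]_n -> (K -> 'cV[K]_m) -> (K -> 'cV[K]_q) -> K -> 'cV[K]_n)
    (P : 'M[K]_n) (kappa : K) (gw : 'cV[K]_q -> K) (gy : 'cV[K]_p -> K) :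
  {within X `*` U `*` W, continuous f} -> {within X `*` U `*` W, continuous h} ->
  solution_map X U W f sol -> P^T = P -> continuous gw -> continuous gy ->
  (forall v, 0 <= gw v) -> (forall v, 0 <= gy v) ->
  (forall x1 x2 u w1 w2, X x1 -> X x2 -> U u -> W w1 -> W w2 ->
    2 * bilin P (f (x1, u, w1) - f (x2, u, w2)) (x1 - x2) <=
    - kappa * wsqnorm P (x1 - x2) +
    (gw (w1 - w2) + gy (h (x1, u, w1) - h (x2, u, w2)))) ->
  dissipative X U W h sol (fun chi => wsqnorm P (chi.1 - chi.2))
    (expR (- kappa)) gw gy.
Proof.
move=> fc hc sol_map Psym gwc gyc gw0 gy0 le T chi1 chi2 u w1 w2 T0 Xchi1 Xchi2.
move=> au aw1 aw2 /=.
set x1 := sol chi1 u w1; set x2 := sol chi2 u w2.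
pose y1 s := h (x1 s, u s, w1 s); pose y2 s := h (x2 s, u s, w2 s).
have [sol1 _] := sol_map chi1 u w1 Xchi1 au aw1.
have [sol2 _] := sol_map chi2 u w2 Xchi2 au aw2.
have [su uc] := admissible_discontinuities T au.
have [s1 w1c] := admissible_discontinuities T aw1.
have [s2 w2c] := admissible_discontinuities T aw2.
have f1_int t i : 0 <= t -> lebesgue_measure.-integrable `[0, t]
    (EFin \o fun s => f (x1 s, u s, w1 s) i ord0).
  by move=> t0; have [_ /(_ t i t0)[]] := sol1.
have f2_int t i : 0 <= t -> lebesgue_measure.-integrable `[0, t]
    (EFin \o fun s => f (x2 s, u s, w2 s) i ord0).
  by move=> t0; have [_ /(_ t i t0)[]] := sol2.
have diff_coord (a b : 'cV[K]_n) i : (a - b) i ord0 = a i ord0 - b i ord0.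
  by rewrite !mxE.
(* The listed times cover the discontinuities of u, w1 and w2 in ]0, T[; elsewhere velocities and
   outputs are continuous along the solutions. *)
apply: (@integral_dissipation _ _ P kappa T (fun t => x1 t - x2 t)
  (fun t => f (x1 t, u t, w1 t) - f (x2 t, u t, w2 t)) (chi1 - chi2)
  (fun t => gw (w1 t - w2 t) + gy (y1 t - y2 t)) (su ++ s1 ++ s2)) => //.
- move=> i; have := integrableB _ (f1_int T i T0) (f2_int T i T0).
  move=> /(_ (measurable_itv _)); apply: eq_integrable => // t _.
  by rewrite /= diff_coord.
- move=> t i /andP[t0 _]; rewrite !diff_coord.
  under eq_Rintegral do rewrite diff_coord.
  rewrite RintegralB//; [|exact: f1_int|exact: f2_int].
  have [_ /(_ t i t0)[_]] := sol1; have [_ /(_ t i t0)[_]] := sol2.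
  by rewrite /x1 /x2 => -> ->; ring.
- move=> t tT; rewrite !mem_cat !negb_or => /and3P[tu t1 t2].
  have t0 : 0 < t by move: tT; rewrite in_itv/= => /andP[].
  have ut := uc t tT tu; have w1t := w1c t tT t1; have w2t := w2c t tT t2.
  split=> [|i].
    apply: cvgD.
      apply: (@cvg_comp _ _ _ _ gw _ (nbhs (w1 t - w2 t))); last exact: gwc.
      exact: cvgB.
    apply: (@cvg_comp _ _ _ _ gy _ (nbhs (y1 t - y2 t))); last exact: gyc.
    apply: cvgB; [exact: (continuous_along_solution hc sol1)|].
    exact: (continuous_along_solution hc sol2).
  apply: (@cvg_comp _ _ _ _ (fun v : 'cV[K]_n => v i ord0) _
    (nbhs (f (x1 t, u t, w1 t) - f (x2 t, u t, w2 t))));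
    last exact: coord_continuous.
  apply: cvgB; [exact: (continuous_along_solution fc sol1)|].
  exact: (continuous_along_solution fc sol2).
- by move=> t _; rewrite addr_ge0.
- move=> t; rewrite in_itv/= => /andP[/ltW t0 _].
  have [[Uu _ _ _] [Ww1 _ _ _] [Ww2 _ _ _]] := And3 au aw1 aw2.
  apply: le; [exact: sol1.1|exact: sol2.1|exact: Uu|exact: Ww1|exact: Ww2].
Qed.

(** * Class-Kinf bounds and the theorem *)

Lemma class_Kinf_sqr (K : realType) (c : K) :
  0 < c -> class_Kinf (fun s => c * s ^+ 2).
Proof.
move=> c0; split.
- apply: continuous_subspaceT => s; apply: cvgM; first exact: cvg_cst.
  exact: exprn_continuous.
- by rewrite expr0n mulr0.
- by move=> s t s0 st; rewrite ltr_pM2l// ltrXn2r// (le_trans s0 (ltW st)).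
- move=> M; have Mc : 0 <= `|M| / c by rewrite divr_ge0// ltW.
  (* As s = 1 + |M| / c is at least 1, c s^2 >= c s = c + |M| > M. *)
  exists (1 + `|M| / c); first by rewrite addr_ge0.
  apply: (@lt_le_trans _ _ (c * (1 + `|M| / c))).
    by rewrite mulrDr mulr1 mulrC divfK ?gt_eqF// ltr_pwDl// ler_norm.
  by rewrite ler_pM2l// expr2 ler_peMl// ?addr_ge0// lerDl.
Qed.

Lemma sqr_enorm_continuous (K : realType) n (c : K) :
  continuous (fun v : 'cV[K]_n => c * enorm v ^+ 2).
Proof.
have -> : (fun v : 'cV[K]_n => c * enorm v ^+ 2) = wsqnorm c%:M.
  apply/funext => v.
  by rewrite sqr_enormE /wsqnorm mul_mx_scalar -scalemxAl [RHS]mxE.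
exact: wsqnorm_continuous.
Qed.

Unset Implicit Arguments.
Set Strict Implicit.

Theorem theorem2 (K : realType) (n m q p : nat)
    (X : set 'cV[K]_n) (U : set 'cV[K]_m) (W : set 'cV[K]_q) (Y : set 'cV[K]_p)
    (f : 'cV[K]_n * 'cV[K]_m * 'cV[K]_q -> 'cV[K]_n)
    (h : 'cV[K]_n * 'cV[K]_m * 'cV[K]_q -> 'cV[K]_p)
    (sol : 'cV[K]_n -> (K -> 'cV[K]_m) -> (K -> 'cV[K]_q) -> K -> 'cV[K]_n)
    (A : 'cV[K]_n * 'cV[K]_m * 'cV[K]_q -> 'M[K]_n)
    (E : 'cV[K]_n * 'cV[K]_m * 'cV[K]_q -> 'M[K]_(n, m))
    (B : 'cV[K]_n * 'cV[K]_m * 'cV[K]_q -> 'M[K]_(n, q))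
    (C : 'cV[K]_n * 'cV[K]_m * 'cV[K]_q -> 'M[K]_(p, n))
    (D : 'cV[K]_n * 'cV[K]_m * 'cV[K]_q -> 'M[K]_(p, q))
    (X_closed : closed X) (W_closed : closed W)
    (f_cont : {within X `*` U `*` W, continuous f})
    (h_cont : {within X `*` U `*` W, continuous h})
    (h_Y : forall z, (X `*` U `*` W) z -> Y (h z))
    (sol_map : solution_map X U W f sol)
    (f_C1 : C1_on X U W f A E B)
    (h_affine : affine_in_xw X U W h)
    (h_partials : partials_xw X U W h C D)
    (X_convex : convex_set X) (W_convex : convex_set W)
    (P : 'M[K]_n) (Q : 'M[K]_q) (R : 'M[K]_p) (kappa : K)
    (P_posdef : posdef P) (Q_posdef : posdef Q) (R_posdef : posdef R)
    (kappa_gt0 : 0 < kappa)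
    (lmi : forall z, (X `*` U `*` W) z ->
       negsemidef
         (block_mx
            (P *m A z + (A z)^T *m P + kappa *: P - (C z)^T *m R *m C z)
            (P *m B z - (C z)^T *m R *m D z)
            ((B z)^T *m P - (D z)^T *m R *m C z)
            (- ((D z)^T *m R *m D z) - Q))) :
  let V := fun chi : 'cV[K]_n * 'cV[K]_n => wsqnorm P (chi.1 - chi.2) in
  [/\ smooth V,
      iiIOSS_Lyapunov X U W h sol V,
      (forall chi1 chi2, X chi1 -> X chi2 ->
         wsqnorm P (chi1 - chi2) <= V (chi1, chi2) <= wsqnorm P (chi1 - chi2))
    & dissipative X U W h sol V (expR (- kappa)) (wsqnorm Q) (wsqnorm R)].
Proof.
move=> V.
have [[Psym _] [Rsym _]] := (P_posdef, R_posdef).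
have pointwise := lmi_dissipation f_cont f_C1 h_affine h_partials X_convex
  W_convex Psym Rsym lmi.
split.
- exact: smooth_wsqnorm_sub.
(* The two bounds on the P-norm give alpha1 and alpha2; the upper bounds on the Q- and R-norms
   enlarge the supply rate to functions of the Euclidean norm. *)
- have [cP1 cP1_gt0 cP1_le] := posdef_ge_sqr_enorm P_posdef.
  have [cP2 cP2_gt0 leP2] := wsqnorm_le_sqr_enorm P.
  have [cQ cQ_gt0 leQ] := wsqnorm_le_sqr_enorm Q.
  have [cR cR_gt0 leR] := wsqnorm_le_sqr_enorm R.
  split.
  + apply: continuous_subspaceT => z.
    (* Continuity is smoothness of order 0. *)
    have [+ _] := smooth_wsqnorm_sub P 0; exact.
  + by move=> chi1 chi2 _ _; exact: posdef_wsqnorm_ge0.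
  + exists (fun s => cP1 * s ^+ 2), (fun s => cP2 * s ^+ 2),
      (fun s => cQ * s ^+ 2), (fun s => cR * s ^+ 2), (expR (- kappa)).
    split.
    * by split; exact: class_Kinf_sqr.
    * by rewrite expR_ge0 -[ltRHS]expR0 ltr_expR oppr_lt0.
    * by move=> chi1 chi2 _ _; rewrite cP1_le leP2.
    * apply: (dissipative_wsqnorm f_cont h_cont sol_map) => //.
      - exact: sqr_enorm_continuous.
      - exact: sqr_enorm_continuous.
      - by move=> v; rewrite mulr_ge0 ?sqr_ge0// ltW.
      - by move=> v; rewrite mulr_ge0 ?sqr_ge0// ltW.
      - move=> x1 x2 u w1 w2 Xx1 Xx2 Uu Ww1 Ww2.
        apply: le_trans (pointwise _ _ _ _ _ Xx1 Xx2 Uu Ww1 Ww2) _.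
        by rewrite -addrA lerD2l lerD.
- by move=> chi1 chi2 _ _; rewrite lexx.
- apply: (dissipative_wsqnorm f_cont h_cont sol_map) => //.
  + exact: wsqnorm_continuous.
  + exact: wsqnorm_continuous.
  + by move=> v; exact: posdef_wsqnorm_ge0.
  + by move=> v; exact: posdef_wsqnorm_ge0.
  + move=> x1 x2 u w1 w2 Xx1 Xx2 Uu Ww1 Ww2; rewrite addrA.
    exact: pointwise.
Qed.
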